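(* For all sufficiently large $d$, $$f(B^d)\ge\left(\log\frac{3}{1+\sqrt3}-O\left(\frac{\log d}{d}\right)\right)d\,3^{-d}.$$ That is, there exist an absolute constant $C>0$ and an integer $d_0$ such that for every integer $d\ge d_0$, $$f(B^d)\ge\left(\log\frac{3}{1+\sqrt3}-C\,\frac{\log d}{d}\right)d\,3^{-d}.$$
   Context: $B^d$ denotes the closed Euclidean unit ball in $\mathbb{R}^d$, $\operatorname{vol}$ denotes $d$-dimensional Lebesgue measure, and $\log$ is the natural logarithm. For a convex body $K\subseteq\mathbb{R}^d$, $f(K)$ denotes the largest constant $c\ge 0$ such that every finite collection $\mathcal{C}$ of translates of $K$ admits a pairwise disjoint subcollection $\mathcal{S}\subseteq\mathcal{C}$ satisfying $\operatorname{vol}\left(\bigcup_{K'\in\mathcal S}K'\right)\geq c\operatorname{vol}\left(\bigcup_{K'\in\mathcal{C}}K'\right)$. Two translates that meet only at boundary points count as intersecting (not disjoint). *)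

(* Defs.v *)
From HB Require Import structures.
From mathcomp Require Import all_boot all_order all_algebra.
From mathcomp Require Import all_classical all_reals all_analysis.

Set Implicit Arguments.
Unset Strict Implicit.
Unset Printing Implicit Defensive.

Import Order.TTheory GRing.Theory Num.Theory.
Import numFieldNormedType.Exports.

Local Open Scope classical_set_scope.
Local Open Scope ring_scope.

Section lebesgue_measure_Rd.
Context (R : realType).
Local Notation tupleR d := (d.-tuple (measurableTypeR R)).

Definition tuple_cons d (p : tupleR d * measurableTypeR R) : tupleR d.+1 :=
  [tuple of p.2 :: p.1].

Lemma measurable_tuple_cons d : measurable_fun setT (@tuple_cons d).
Proof. exact: measurable_cons. Qed.

(* Lebesgue measure on the Borel sets of R^d: the d-fold product of the
   one-dimensional one. The long constant is the library's measure structure on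
   pushforward m f, which takes the measurability of f explicitly. *)
Fixpoint lebesgue_tuple d : {measure set (tupleR d) -> \bar R} :=
  match d with
  | 0 => dirac [tuple]
  | d'.+1 => measure_function_pushforward__canonical__measure_function_Measure
      (lebesgue_tuple d' \x @lebesgue_measure R)%E (@measurable_tuple_cons d')
  end.

Lemma lebesgue_tuple_box d (A : 'I_d -> set (measurableTypeR R)) :
  (forall i, measurable (A i)) ->
  lebesgue_tuple d [set t | forall i, A i (tnth t i)] =
  (\prod_(i < d) lebesgue_measure (A i))%E.
Proof.
elim: d A => [|d IH] A mA.
  rewrite big_ord0 /= diracE mem_set//; by case.
rewrite big_ord_recl /= /pushforward.
rewrite (_ : _ @^-1` _ =
    [set t : tupleR d | forall i, A (lift ord0 i) (tnth t i)] `*` A ord0).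
  rewrite product_measure1E.
  - by rewrite (IH (fun i => A (lift ord0 i)))// muleC.
  - rewrite (_ : [set t : tupleR d | _] =
       \bigcap_(i in [set: 'I_d]) ((@tnth d _)^~ i @^-1` A (lift ord0 i))).
      apply: fin_bigcap_measurable => // i _.
      by rewrite -[X in measurable X]setTI; exact: measurable_tnth.
    by apply/seteqP; split => [t h i _|t h i]; [exact: h|exact: (h i)].
  - exact: mA.
apply/seteqP; split => -[t x] /=.
  move=> h; split => [i|]; last by have := h ord0; rewrite tnth0.
  by have := h (lift ord0 i); rewrite tnthS.
by move=> [h1 h2] i; case: (unliftP ord0 i) => [j|] ->; rewrite ?tnthS ?tnth0.
Qed.

End lebesgue_measure_Rd.

Section disjoint_translates.
Context (R : realType) (d : nat).
Implicit Types K : set 'rV[R]_d.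

Definition vol (A : set 'rV[R]_d) : \bar R :=
  lebesgue_tuple R d [set t | A (\row_i tnth t i)].

(* `|v| is the sup norm on 'rV[R]_d, hence an explicit Euclidean norm. *)
Definition euclidean_norm (v : 'rV[R]_d) : R :=
  Num.sqrt (\sum_i v ord0 i ^+ 2).

Definition euclidean_unit_ball : set 'rV[R]_d :=
  [set v | euclidean_norm v <= 1].

Definition translates K : set (set 'rV[R]_d) :=
  [set A | exists v, A = [set x + v | x in K]].

Definition disjoint_fractions K : set R :=
  [set c | 0 <= c /\
    forall C : set (set 'rV[R]_d), finite_set C -> C `<=` translates K ->
    exists S : set (set 'rV[R]_d),
      [/\ S `<=` C, trivIset S id &
          (c%:E * vol (\bigcup_(A in C) A) <= vol (\bigcup_(A in S) A))%E]].

(* The largest element of disjoint_fractions K. For a convex body K the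
   supremum is attained: each finite C has only finitely many subcollections,
   so it bounds c by a maximum of finitely many ratios of volumes. *)
Definition max_disjoint_fraction K : R := sup (disjoint_fractions K).

End disjoint_translates.

Arguments euclidean_unit_ball : clear implicits.

(* Main.v *)
(* Hard-core model. Let [U] be the union of the balls, cut into cells, one per
   centre, and weight each centre by the volume of its cell, so that the total
   weight is [vol U]. Balls intersect when their centres are at distance at most
   [2], so in units of the volume of the unit ball:
   - the neighbours of a centre have weight at most [3^d];
   - those at distance at most [2 - e] have weight at most [(3 - e)^d], a
     negligible fraction of [3^d] once [e] is of order [log d / d];
   - two centres at distance in [2 - e, 2] have common neighbours of weight at
     most [K = (1 + sqrt (3 + e))^d], since the lens of the two balls of radius
     [2] lies in a ball of radius [sqrt (3 + e)].
   Draw an independent set [I] with probability proportional to the product of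
   the weights scaled by [lambda], where [lambda K = 1/d]. Given the part of [I]
   off the neighbourhood of [x], let [f] be the scaled weight of the vertices
   still free next to [x]: the probability that none of them is chosen is at
   least [exp (- f)], and as the free graph is sparse their expected number is
   at least [(1 - 1/d) f]. Averaging over [x] bounds the mean of [|I|] below in
   two ways, one good for small [f] and the other for large [f]; the balance
   gives [|I| >= (log (3^d / K) - O(log d)) 3^-d vol U]. *)

Require Import Defs.
From mathcomp Require Import all_boot all_order all_algebra.
From mathcomp Require Import boolp reals sequences exp.
From mathcomp Require Import lra ring.

Import Order.TTheory GRing.Theory Num.Theory.

Set Implicit Arguments.
Unset Strict Implicit.
Unset Printing Implicit Defensive.

Local Open Scope ring_scope.

(** * Independent sets in weighted graphs with small codegrees *)

(** [N] will be reflexive, since a ball meets itself; hence adjacent members are required to be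
    equal rather than forbidden. *)
Definition independent (T : finType) (N : rel T) (I : {set T}) :=
  [forall x in I, forall y in I, N x y ==> (x == y)].

Definition avoids (T : finType) (Q : pred T) (I : {set T}) :=
  [forall y in I, ~~ Q y].

Section HardCore.
Context {R : realType} {T : finType} (N : rel T) (u : T -> R).
Hypotheses (Nrefl : reflexive N) (Nsym : symmetric N) (u_ge0 : forall x, 0 <= u x).
Implicit Types (I J L F A : {set T}) (Q : pred T) (x y z : T).

Local Notation wt I := (\prod_(x in I) u x).
Local Notation indep := (independent N).

Let wt_ge0 I : 0 <= wt I.
Proof. by apply: prodr_ge0. Qed.

Lemma independentP I :
  reflect {in I &, forall x y, N x y -> x = y} (indep I).
Proof.
apply: (iffP forall_inP) => [h x y xI yI Nxy|h x xI].
  by apply/eqP; move/forall_inP : (h x xI) => /(_ y yI) /implyP; apply.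
by apply/forall_inP => y yI; apply/implyP => Nxy; apply/eqP/h.
Qed.

Lemma avoidsP Q I : reflect {in I, forall y, ~~ Q y} (avoids Q I).
Proof. exact: forall_inP. Qed.

Lemma independentU1 x I : x \notin I ->
  indep (x |: I) = indep I && avoids (N x) I.
Proof.
move=> xI; apply/independentP/andP => [h|[/independentP h /avoidsP hx] y z].
  split.
    by apply/independentP => y z yI zI; apply: h; rewrite !inE ?yI ?zI orbT.
  apply/avoidsP => y yI; apply/negP => Nxy; move: xI.
  by rewrite (h x y) ?yI// !inE ?eqxx// yI orbT.
rewrite !inE => /predU1P[->|yI] /predU1P[->|zI] //.
- by move=> Nxz; have := hx z zI; rewrite Nxz.
- by rewrite Nsym => Nxz; have := hx y yI; rewrite Nxz.
- exact: h.
Qed.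

(** Deleting [x] is a bijection onto the sets counted on the right: as [N x x] holds, avoiding [N x]
    already excludes [x]. *)
Lemma hardcore_member F x : x \in F ->
  \sum_(I : {set T} | [&& I \subset F, indep I & x \in I]) wt I =
  u x * \sum_(I : {set T} | [&& I \subset F, indep I & avoids (N x) I]) wt I.
Proof.
move=> xF; rewrite big_distrr/= (reindex_onto
  (fun I : {set T} => x |: I) (fun I : {set T} => I :\ x)).
  apply: eq_big => [I|I /andP[_ /eqP <-]].
    have [xI|xI] := boolP (x \in I).
      rewrite (_ : avoids _ _ = false) ?andbF.
        by apply/negP => /andP[_ /eqP] /setP/(_ x); rewrite !inE xI eqxx.
      by apply/negP => /avoidsP/(_ x xI); rewrite Nrefl.
    rewrite setU1K// eqxx andbT setU11 andbT independentU1//.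
    by rewrite subUset sub1set xF.
  by rewrite big_setU1//= !inE eqxx.
by move=> I /and3P[_ _ xI]; rewrite setD1K.
Qed.

Lemma sum_mul_card (P : pred {set T}) Q :
  \sum_(I : {set T} | P I) wt I * #|[set x in I | Q x]|%:R =
  \sum_(x | Q x) \sum_(I : {set T} | P I && (x \in I)) wt I.
Proof.
rewrite (exchange_big_dep P)/=; last by move=> ? ? _ /andP[].
apply: eq_bigr => I PI.
rewrite sumr_const mulr_natr; congr (_ *+ _); apply: eq_card => x.
by rewrite !inE PI andbC.
Qed.

(** Union bound: a set that meets [Q] has count at least 1. *)
Lemma sum_le_avoids (P : pred {set T}) Q :
  \sum_(I : {set T} | P I) wt I <=
  \sum_(I : {set T} | P I && avoids Q I) wt I
  + \sum_(I : {set T} | P I) wt I * #|[set x in I | Q x]|%:R.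
Proof.
rewrite [leLHS](bigID (avoids Q))/= lerD2l.
rewrite [leRHS](bigID (avoids Q))/=; apply: ler_wpDl.
  by apply: sumr_ge0 => I _; rewrite mulr_ge0.
apply: ler_sum => I /andP[_]; rewrite /avoids negb_forall.
move=> /existsP[x]; rewrite negb_imply negbK => /andP[xI Qx].
by rewrite ler_peMr// ler1n card_gt0; apply/set0Pn; exists x; rewrite !inE xI.
Qed.

Lemma hardcore_member_le F x : x \in F ->
  \sum_(I : {set T} | [&& I \subset F, indep I & x \in I]) wt I <=
  u x * \sum_(I : {set T} | (I \subset F) && indep I) wt I.
Proof.
move=> xF; rewrite hardcore_member// ler_wpM2l//.
rewrite [leRHS](bigID (avoids (N x)))/=.
under eq_bigl do rewrite andbA.
by rewrite ler_wpDr// sumr_ge0.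
Qed.

(** Up to the normalising sum, [y] is present with probability [u y] times that of avoiding its
    closed neighbourhood. Each [z] there is present with probability at most [u z], so the union
    bound leaves at least [1 - k]. *)
Lemma hardcore_card_ge F (k : R) : 
  {in F, forall y, \sum_(z in F | N y z) u z <= k} ->
  (1 - k) * (\sum_(x in F) u x) * \sum_(I : {set T} | (I \subset F) && indep I) wt I <=
  \sum_(I : {set T} | (I \subset F) && indep I) wt I * #|I|%:R.
Proof.
move=> hk; set Z := \sum_(I : {set T} | (I \subset F) && indep I) wt I.
have -> : \sum_(I : {set T} | (I \subset F) && indep I) wt I * #|I|%:R =
    \sum_(x in F) \sum_(I : {set T} | [&& I \subset F, indep I & x \in I]) wt I.
  under [RHS]eq_bigr do under eq_bigl do rewrite andbA.
  rewrite -sum_mul_card; apply: eq_bigr => I /andP[/subsetP IF _].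
  congr (_ * _%:R); apply: eq_card => x; rewrite !inE andbC.
  by case: (boolP (x \in I)) => [/IF->|]; rewrite ?andbF.
rewrite mulrAC mulr_sumr; apply: ler_sum => y yF.
rewrite hardcore_member// mulrC ler_wpM2l// mulrBl mul1r lerBlDr.
apply: (le_trans (sum_le_avoids _ (N y))).
under [X in X + _]eq_bigl do rewrite -andbA.
rewrite lerD2l (@le_trans _ _ (\sum_(z in F | N y z) u z * Z))//; last first.
  by rewrite -mulr_suml ler_wpM2r ?sumr_ge0// hk.
rewrite sum_mul_card (bigID (mem F))/= [X in _ + X]big1 ?addr0.
  under eq_bigl do rewrite andbC.
  apply: ler_sum => z /andP[zF _].
  under eq_bigl do rewrite -andbA.
  exact: hardcore_member_le.
move=> z /andP[_ /negP zF]; rewrite big_pred0// => I.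
by apply/negP => /andP[/andP[/subsetP IF _] /IF].
Qed.

(** Dropping independence gives the expansion of the product of the [u x + 1], and each factor is at
    most [expR (u x)]. *)
Lemma hardcore_partition_le F :
  \sum_(I : {set T} | (I \subset F) && indep I) wt I <= expR (\sum_(x in F) u x).
Proof.
rewrite expR_sum.
apply: (@le_trans _ _ (\prod_(x in F) (u x + 1))); last first.
  by apply: ler_prod => x _; rewrite addr_ge0//= addrC expR_ge1Dx.
rewrite [leRHS]big_mkcond/=.
have -> : \prod_x (if x \in F then u x + 1 else 1) =
  \prod_x ((if x \in F then u x else 0) + 1).
  by apply: eq_bigr => x _; case: ifP; rewrite ?add0r.
rewrite bigA_distr/= [leRHS](bigID (fun I => (I \subset F) && indep I))/=.
apply: ler_wpDr.
  apply: sumr_ge0 => I _; apply: prodr_ge0 => x _.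
  by case: ifP => // _; case: ifP.
apply: ler_sum => I /andP[/subsetP IF _].
rewrite big_mkcond/=; apply: ler_prod => x _.
by case: ifPn => [xI|]; rewrite ?IF// ?lexx ?ler01 ?u_ge0.
Qed.


Lemma independentU I J : indep (I :|: J) =
  [&& indep I, indep J & [forall y in J, (y \in I) || avoids (N y) I]].
Proof.
apply/independentP/and3P => [h|[/independentP hI /independentP hJ hIJ]].
  split; last first.
  - apply/forall_inP => y yJ; apply/orP; case: (boolP (y \in I)) => [|yI].
      by left.
    right; apply/avoidsP => z zI; apply: contra yI => Nyz.
    by rewrite (h y z)// !inE ?zI ?yJ ?orbT.
  - by apply/independentP => x y xJ yJ; apply: h; rewrite !inE ?xJ ?yJ orbT.
  - by apply/independentP => x y xI yI; apply: h; rewrite !inE ?xI ?yI.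
have sep x y : x \in I -> y \in J -> N x y -> x = y.
  move=> xI yJ Nxy; move/forall_inP : hIJ => /(_ y yJ) /orP[yI|].
    exact: hI.
  by move=> /avoidsP/(_ x xI); rewrite Nsym Nxy.
move=> x y; rewrite !inE => /orP[xI|xJ] /orP[yI|yJ].
- exact: hI.
- exact: sep.
- by rewrite Nsym => Nxy; apply/esym/sep.
- exact: hJ.
Qed.

(* Conditioning on the part [J] of [I] outside [A]: the part inside [A] is an
   independent subset of the vertices of [A] not blocked by [J]. *)
Lemma hardcore_condition A Q (g : {set T} -> R) : {in A, forall x, ~~ Q x} ->
  \sum_(I : {set T} | indep I && avoids Q I) wt I * g (I :&: A) =
  \sum_(J : {set T} | [&& indep J, avoids Q J & [disjoint J & A]]) wt J *
    \sum_(L : {set T} | (L \subset [set y in A | avoids (N y) J]) && indep L)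
      wt L * g L.
Proof.
move=> AQ.
rewrite (partition_big (fun I : {set T} => I :\: A)
  (fun J : {set T} => [&& indep J, avoids Q J & [disjoint J & A]]))/=; last first.
  move=> I /andP[/independentP iI /avoidsP QI]; apply/and3P; split.
  - by apply/independentP => x y; rewrite !inE => /andP[_ xI] /andP[_ yI]; exact: iI.
  - by apply/avoidsP => x; rewrite !inE => /andP[_]; exact: QI.
  - by rewrite -setI_eq0; apply/eqP/setP => x; rewrite !inE; case: (x \in A); rewrite ?andbF.
apply: eq_bigr => J /and3P[iJ QJ dJA]; rewrite big_distrr/=.
have JA x : x \in J -> (x \in A) = false by exact: disjointFr.
rewrite (reindex_onto (fun L : {set T} => J :|: L) (fun I : {set T} => I :&: A))/=.
  apply: eq_big => [L|L /andP[/andP[_ /eqP hD] /eqP hI]].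
    rewrite independentU iJ/=.
    apply/idP/idP.
      move=> /andP[/andP[/andP[/andP[iL /forall_inP fL] _] /eqP hD] /eqP hI].
      have LA x : x \in L -> x \in A by move/setP : hI => <-; rewrite inE => /andP[].
      rewrite iL andbT; apply/subsetP => x xL; rewrite inE LA//=.
      by have /orP[/JA|//] := fL _ xL; rewrite LA.
    move=> /andP[/subsetP LF iL]; rewrite iL /=.
    have LA x : x \in L -> x \in A by move/LF; rewrite inE => /andP[].
    rewrite -!andbA; apply/and4P; split.
    - by apply/forall_inP => y /LF; rewrite inE => /andP[_ ->]; rewrite orbT.
    - apply/avoidsP => x; rewrite inE => /orP[|/LA/AQ//].
      by move: QJ => /avoidsP; exact.
    - apply/eqP/setP => x; rewrite !inE.
      case: (boolP (x \in J)) => [/JA ->//|_] /=.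
      by case: (boolP (x \in L)) => [/LA ->|]//; rewrite ?andbF.
    - apply/eqP/setP => x; rewrite !inE.
      case: (boolP (x \in J)) => [xJ|_] /=.
        by rewrite (JA _ xJ); apply/esym/negP => /LA; rewrite JA.
      by case: (boolP (x \in L)) => [/LA ->|].
  rewrite hI mulrA; congr (_ * _).
  rewrite -bigU//=; last first.
    apply: (disjointWr _ dJA); apply/subsetP => x.
    by move/setP : hI => <-; rewrite inE => /andP[].
  by apply: eq_bigl => x; rewrite !inE.
by move=> I /andP[_ /eqP <-]; rewrite setUC setID.
Qed.

(** [c] marks the neighbours of [x] exempt from the codegree bound. Given the part of the set
    outside the other neighbours, let [f] be their free weight. None of them is chosen with
    probability at least [expR (- f)]. The tangent bound [expR (- f) >= expR (- a) * (1 + a - f)] is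
    linear in [f], and [f] is controlled by the expected number chosen. *)
Lemma hardcore_local (c : rel T) x (k a : R) : k < 1 -> subrel c N ->
  (forall y, N x y -> ~~ c x y -> \sum_(z | N x z && N y z) u z <= k) ->
  expR (- a) *
    ((1 + a) * (\sum_(I : {set T} | indep I && avoids (c x) I) wt I)
     - (1 - k)^-1 *
       \sum_(I : {set T} | indep I) wt I * #|[set y in I | N x y]|%:R)
  <= \sum_(I : {set T} | indep I && avoids (N x) I) wt I.
Proof.
move=> k1 cN codeg; pose A : {set T} := [set y | N x y && ~~ c x y].
have Ac : {in A, forall y, ~~ c x y} by move=> y; rewrite inE => /andP[].
have avoidsN I : indep I && avoids (N x) I =
    [&& indep I, avoids (c x) I & [disjoint I & A]].
  congr andb; apply/avoidsP/andP => [h|[/avoidsP hc dIA] y yI].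
    split; first by apply/avoidsP => y /h; apply: contra; exact: cN.
    by apply/pred0P => y /=; apply/negP => /andP[/h]; rewrite inE => /negPf ->.
  apply/negP => Nxy; have := disjointFr dIA yI.
  by rewrite inE Nxy hc.
pose g1 (I : {set T}) : R := 1; pose g2 (I : {set T}) : R := #|I|%:R.
have -> : \sum_(I : {set T} | indep I && avoids (c x) I) wt I =
    \sum_(I : {set T} | indep I && avoids (c x) I) wt I * g1 (I :&: A).
  by apply: eq_bigr => I _; rewrite /g1 mulr1.
(* Requiring [c x] to be avoided and counting only inside [A] can only lower the sum. *)
have card_ge : \sum_(I : {set T} | indep I && avoids (c x) I) wt I * g2 (I :&: A)
    <= \sum_(I : {set T} | indep I) wt I * #|[set y in I | N x y]|%:R.
  rewrite [leRHS](bigID (avoids (c x)))/= ler_wpDr//.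
    by apply: sumr_ge0 => I _; rewrite mulr_ge0.
  apply: ler_sum => I _; rewrite ler_wpM2l// ler_nat subset_leq_card//.
  by apply/subsetP => y; rewrite !inE => /and3P[-> ->].
apply: (@le_trans _ _ (expR (- a) *
    ((1 + a) * (\sum_(I : {set T} | indep I && avoids (c x) I) wt I * g1 (I :&: A))
    - (1 - k)^-1 *
      \sum_(I : {set T} | indep I && avoids (c x) I) wt I * g2 (I :&: A)))).
  by rewrite ler_wpM2l ?expR_ge0// lerD2l lerN2 ler_wpM2l// invr_ge0 subr_ge0 ltW.
rewrite !hardcore_condition// (eq_bigl _ _ avoidsN) !mulr_sumr -sumrB mulr_sumr.
apply: ler_sum => J _; set F := [set y in A | _].
have FA y : y \in F -> N x y && ~~ c x y.
  by rewrite inE => /andP[+ _]; rewrite inE.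
have kF : {in F, forall y, \sum_(z in F | N y z) u z <= k}.
  move=> y /FA/andP[Nxy cxy]; apply: le_trans (codeg y Nxy cxy).
  rewrite big_mkcond [leRHS]big_mkcond; apply: ler_sum => z _.
  case: (boolP (z \in F)) => [/FA/andP[-> _]|_] //=.
  by case: ifP.
have Ege := hardcore_card_ge kF; have Zle := hardcore_partition_le F.
set f := \sum_(y in F) u y in Ege Zle.
set Z := \sum_(I : {set T} | _) wt I in Ege Zle.
set E := \sum_(I : {set T} | _) _ in Ege.
rewrite -/E (eq_bigr (fun L : {set T} => wt L)) -/Z; last first.
  by move=> L _; rewrite /g1 mulr1.
have Z0 : 0 <= Z by apply: sumr_ge0.
have k0 : 0 < 1 - k by rewrite subr_gt0.
(* For each [J], avoiding all of [N x] leaves only the empty choice in [A], of weight 1. *)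
suff : expR (- a) * ((1 + a) * Z - (1 - k)^-1 * E) <= 1.
  move=> h; rewrite -[leRHS]mulr1.
  rewrite (_ : expR _ * _ = wt J * (expR (- a) * ((1 + a) * Z - (1 - k)^-1 * E))).
    exact: ler_wpM2l.
  ring.
(* Next, [1 + (a - f) <= expR (a - f)] and [Z <= expR f] make the exponentials cancel. *)
have h1 : f * Z <= (1 - k)^-1 * E by rewrite ler_pdivlMl// mulrA.
apply: (@le_trans _ _ (expR (- a) * ((1 + (a - f)) * Z))).
  by rewrite ler_wpM2l ?expR_ge0//; lra.
apply: (@le_trans _ _ (expR (- a) * (expR (a - f) * expR f))).
  rewrite ler_wpM2l ?expR_ge0//.
  apply: (le_trans (ler_wpM2r Z0 (expR_ge1Dx _))).
  by rewrite ler_wpM2l ?expR_ge0.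
by rewrite -!expRD subrK addNr expR0.
Qed.

(** After exchanging the sums, each [y] in [I] is charged the weight of its [r]-neighbours, at most
    [B]. *)
Lemma sum_weight_card_le (P : pred {set T}) (r : rel T) (B : R) : symmetric r ->
  (forall x, \sum_(y | r x y) u y <= B) ->
  \sum_x u x * \sum_(I : {set T} | P I) wt I * #|[set y in I | r x y]|%:R
  <= B * \sum_(I : {set T} | P I) wt I * #|I|%:R.
Proof.
move=> rsym rB; under eq_bigr do rewrite mulr_sumr.
rewrite exchange_big/= mulr_sumr; apply: ler_sum => I _.
under eq_bigr do rewrite mulrCA.
rewrite -mulr_sumr mulrCA ler_wpM2l//.
apply: (@le_trans _ _ (\sum_(y in I) \sum_(x | r y x) u x)).
  rewrite (exchange_big_dep predT)//=.
  rewrite le_eqVlt; apply/orP; left; apply/eqP; apply: eq_bigr => x _.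
  rewrite sumr_const mulr_natr; congr (_ *+ _); apply: eq_card => y.
  by rewrite !inE rsym.
rewrite mulr_natr -sumr_const.
by apply: ler_sum.
Qed.

End HardCore.

(** * Averaging the local bound over all vertices *)

Section IndependentSet.
Context {R : realType} {T : finType} (N c : rel T) (u : T -> R).

(** If every independent set were too small, so would be the mean [E / Z]. Summing [hardcore_local]
    against [u] then forces a larger mean; the last hypothesis on [a] is what closes the
    contradiction. *)
Lemma large_independent_set (D delta k a : R) :
  reflexive N -> symmetric N -> symmetric c -> subrel c N ->
  (forall x, 0 <= u x) ->
  (forall x, \sum_(y | N x y) u y <= D) ->
  (forall x, \sum_(y | c x y) u y <= delta * D) ->
  (forall x y, N x y -> ~~ c x y -> \sum_(z | N x z && N y z) u z <= k) ->
  0 < D -> 0 <= delta -> 0 <= k -> k < 1 -> 0 <= a ->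
  a <= D * expR (- a) * (1 - (1 + a) * delta * a) ->
  exists I : {set T}, independent N I /\
    (1 - k) * a * (\sum_x u x) / D <= #|I|%:R.
Proof.
move=> Nrefl Nsym csym cN u0 NB cB codeg D0 delta0 k0 k1 a0 aD.
set U := \sum_x u x; set v := _ / D.
apply: contrapT => /forallNP small.
have {}small I : independent N I -> #|I|%:R < v.
  by move=> iI; rewrite ltNge; apply/negP => h; apply: (small I).
pose wt (I : {set T}) := \prod_(x in I) u x.
have wt0 I : 0 <= wt I by apply: prodr_ge0.
pose Z := \sum_(I : {set T} | independent N I) wt I.
pose E := \sum_(I : {set T} | independent N I) wt I * #|I|%:R.
have i0 : independent N set0 by apply/forall_inP => x; rewrite inE.
have Z0 : 0 < Z.
  rewrite /Z (bigD1 set0)//= ltr_pwDl ?sumr_ge0//.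
  by rewrite /wt big_set0.
(* The empty set, of weight 1, makes this strict. *)
have EvZ : E < v * Z.
  rewrite /E /Z mulr_sumr -subr_gt0 -sumrB (bigD1 set0)//= ltr_pwDl//.
    by rewrite {1 2}/wt big_set0 mul1r mulr1 subr_gt0 small.
  apply: sumr_ge0 => I /andP[iI _].
  by rewrite mulrC subr_ge0 ler_wpM2l// ltW// small.
have U0 : 0 <= U by apply: sumr_ge0.
have E0 : 0 <= E by apply: sumr_ge0 => I _; rewrite mulr_ge0.
(* Thus the right-hand sides of [hardcore_local], weighted by [u], add up to [E] itself. *)
have EE : E = \sum_x u x *
    \sum_(I : {set T} | independent N I && avoids (N x) I) wt I.
  have -> : E = \sum_(I : {set T} | independent N I) wt I * #|[set x in I | predT x]|%:R.
    apply: eq_bigr => I _; congr (_ * _%:R); apply: eq_card => x.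
    by rewrite !inE andbT.
  rewrite sum_mul_card; apply: eq_bigr => x _.
  have := hardcore_member u Nrefl Nsym (in_setT x).
  under eq_bigl do rewrite subsetT/=.
  by under [in RHS]eq_bigl do rewrite subsetT/=.
pose Ec x := \sum_(I : {set T} | independent N I) wt I * #|[set y in I | c x y]|%:R.
pose EN x := \sum_(I : {set T} | independent N I) wt I * #|[set y in I | N x y]|%:R.
have hc : \sum_x u x * Ec x <= delta * D * E by exact: sum_weight_card_le.
have hN : \sum_x u x * EN x <= D * E by exact: sum_weight_card_le.
have ik : 0 < (1 - k)^-1 by rewrite invr_gt0 subr_gt0.
have lowE : expR (- a) * ((1 + a) * (U * Z - delta * D * E) - (1 - k)^-1 * (D * E)) <= E.
  rewrite [leRHS]EE.
  apply: (@le_trans _ _ (\sum_x u x *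
      (expR (- a) * ((1 + a) * (Z - Ec x) - (1 - k)^-1 * EN x)))).
    rewrite [leRHS](_ : _ = expR (- a) * ((1 + a) * (U * Z - \sum_x u x * Ec x)
        - (1 - k)^-1 * \sum_x u x * EN x)); last first.
      rewrite /U mulr_suml -sumrB !mulr_sumr -sumrB mulr_sumr.
      by apply: eq_bigr => x _; ring.
    rewrite ler_wpM2l ?expR_ge0// lerB//.
      by rewrite ler_wpM2l ?addr_ge0// lerD2l lerN2.
    by rewrite ler_wpM2l// ltW.
  apply: ler_sum => x _; rewrite ler_wpM2l//.
  have loc := hardcore_local Nrefl Nsym u0 a k1 cN (codeg x).
  apply: le_trans loc.
  rewrite ler_wpM2l ?expR_ge0// lerD2r ler_wpM2l ?addr_ge0// lerBlDr.
  exact: sum_le_avoids.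
have DE : D * E < (1 - k) * a * U * Z.
  rewrite -ltr_pdivlMl//; apply: (lt_le_trans EvZ).
  by rewrite /v le_eqVlt; apply/orP; left; apply/eqP; ring.
have DE1 : (1 - k)^-1 * (D * E) <= a * (U * Z).
  by rewrite mulrC ler_pdivrMr ?subr_gt0// (le_trans (ltW DE))// le_eqVlt;
    apply/orP; left; apply/eqP; ring.
have UZ0 : 0 <= U * Z by rewrite mulr_ge0// ltW.
have DE2 : D * E <= a * (U * Z).
  apply: (le_trans (ltW DE)); rewrite -!mulrA ler_piMl ?mulr_ge0//; last lra.
  exact: ltW.
(* Inserting the upper bounds [DE1] and [DE2] on [E] into [lowE] yields a lower bound on [E] that
   contradicts [DE]. *)
have : a * (U * Z) <= D * E.
  apply: (@le_trans _ _ (D * expR (- a) * (1 - (1 + a) * delta * a) * (U * Z))).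
    by rewrite ler_wpM2r.
  rewrite -!mulrA ler_pM2l//.
  apply: le_trans lowE; rewrite ler_wpM2l ?expR_ge0//.
  have : (1 + a) * delta * (D * E) <= (1 + a) * delta * (a * (U * Z)).
    by rewrite ler_wpM2l// mulr_ge0// addr_ge0.
  nra.
rewrite leNgt => /negP; apply; apply: (lt_le_trans DE).
rewrite -!mulrA ler_piMl ?mulr_ge0//; last lra.
exact: ltW.
Qed.

End IndependentSet.

From mathcomp Require Import all_classical all_reals all_analysis.
From mathcomp Require Import measurable_realfun.
Import numFieldNormedType.Exports.
Local Open Scope classical_set_scope.
Local Open Scope ring_scope.

(** * Volumes of Euclidean balls *)

Section AffineMaps.
Context {R : realType}.
Local Notation tupleR d := (d.-tuple (measurableTypeR R)).
Implicit Types (r : R).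

(** By uniqueness of Lebesgue measure, half-open intervals suffice. *)
Lemma lebesgue_measure_affine r (r0 : 0 < r) (b : R) (A : set (measurableTypeR R)) :
  measurable A ->
  (r%:E * lebesgue_measure ((fun x : R => r * x + b)%R @^-1` A) = lebesgue_measure A)%E.
Proof.
move=> mA; pose f : measurableTypeR R -> measurableTypeR R := fun x : R => r * x + b.
have mf : measurable_fun setT f by apply: measurable_funD => //; exact: measurable_funM.
pose mu : {measure set (measurableTypeR R) -> \bar R} :=
  measure_function_pushforward__canonical__measure_function_Measure
    lebesgue_measure mf.
pose nu : {measure set (measurableTypeR R) -> \bar R} :=
  mscale (NngNum (ltW r0)) mu.
rewrite -[LHS]/(nu A).
apply/esym/lebesgue_measure_unique => //= _ [[x y]] _ <-.
rewrite /nu /mscale/= /pushforward.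
rewrite (_ : f @^-1` _ = [set` `](x - b) / r, (y - b) / r]]); last first.
  apply/seteqP; split=> z; rewrite /f/= !in_itv/= ltr_pdivrMr// ler_pdivlMr//.
    by rewrite ltrBlDr lerBrDr mulrC.
  by rewrite ltrBlDr lerBrDr mulrC.
rewrite !lebesgue_measure_itv/= !lte_fin ltr_pM2r ?invr_gt0// ltrD2r.
case: ifP => _; last by rewrite mule0.
rewrite -!EFinB -EFinM; congr EFin; field.
exact: lt0r_neq0.
Qed.

Definition affine_tuple d r (b : 'I_d -> R) (t : tupleR d) : tupleR d :=
  [tuple r * tnth t i + b i | i < d].

Lemma measurable_affine_tuple d r (b : 'I_d -> R) :
  measurable_fun setT (affine_tuple r b).
Proof.
apply/measurable_fun_tnthP => i.
rewrite (_ : _ \o _ = fun t : tupleR d => r * tnth t i + b i); last first.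
  by apply/funext => t; rewrite /= tnth_mktuple.
apply: measurable_funD => //; apply: measurable_funM => //.
exact: measurable_tnth.
Qed.

(** Induction by slicing: the hypothesis identifies the measure in dimension [d] with [r ^+ d] times
    its pushforward, which changes variables in the integral, and the one-dimensional case rescales
    each slice. *)
Lemma lebesgue_tuple_affine d r (b : 'I_d -> R) (A : set (tupleR d)) :
  0 < r -> measurable A ->
  ((r ^+ d)%:E * lebesgue_tuple R d (affine_tuple r b @^-1` A) =
   lebesgue_tuple R d A)%E.
Proof.
move=> r0; elim: d b A => [|d IH] b A mA.
  (* In dimension 0 the measure is the Dirac mass at the only tuple. *)
  rewrite expr0 mul1e /= !diracE; congr (_%:R%:E); congr nat_of_bool.
  by apply/idP/idP; rewrite !inE /=; congr A; apply/eq_from_tnth => -[].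
pose mc := @measurable_tuple_cons R d.
pose b' i := b (lift ord0 i).
pose P := @tuple_cons R d @^-1` A.
have mP : measurable P by rewrite -[P]setTI; exact: mc.
pose G t := lebesgue_measure (xsection P t).
have mG : measurable_fun setT G by exact: measurable_fun_xsection.
pose mu : {measure set (tupleR d) -> \bar R} :=
  measure_function_pushforward__canonical__measure_function_Measure
    (lebesgue_tuple R d) (measurable_affine_tuple r b').
have rd0 : 0 <= r ^+ d by rewrite exprn_ge0// ltW.
pose nu : {measure set (tupleR d) -> \bar R} := mscale (NngNum rd0) mu.
have -> : lebesgue_tuple R d.+1 A = (\int[lebesgue_tuple R d]_t G t)%E by [].
rewrite (@eq_measure_integral _ _ _ _ nu); last first.
  by move=> B mB _; rewrite /nu /= /mscale/= -(IH b' B mB).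
rewrite ge0_integral_mscale//=.
rewrite (ge0_integral_pushforward (measurable_affine_tuple r b'))//=.
rewrite preimage_setT exprS EFinM -muleA muleCA; congr (_ * _)%E.
rewrite -ge0_integralZl//=; last 2 first.
- apply: measurable_fun_xsection; rewrite -[X in measurable X]setTI.
  exact: (measurableT_comp (measurable_affine_tuple r b) mc).
- by rewrite lee_fin ltW.
apply: eq_integral => t _.
rewrite -[RHS](lebesgue_measure_affine r0 (b ord0)); last first.
  exact: (measurable_xsection _ mP).
congr (_ * lebesgue_measure _)%E.
have fE x : affine_tuple r b (tuple_cons (t, x)) =
    tuple_cons (affine_tuple r b' t, r * x + b ord0).
  apply: eq_from_tnth => i; rewrite tnth_mktuple.
  by case: (unliftP ord0 i) => [j|] ->; rewrite ?tnthS ?tnth0 ?tnth_mktuple.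
by apply/seteqP; split => x; rewrite /xsection/= !inE /P /= fE.
Qed.

End AffineMaps.

(** * Norm inequalities, lenses and the volume of a ball *)

Section EuclideanBalls.
Context {R : realType} {d : nat}.
Implicit Types (u v x y m : 'rV[R]_d) (r p q : R).

Definition closed_ball x r : set 'rV[R]_d := [set y | euclidean_norm (y - x) <= r].

Lemma euclidean_norm_le v r : 0 <= r ->
  (euclidean_norm v <= r) = (\sum_i v ord0 i ^+ 2 <= r ^+ 2).
Proof.
move=> r0; rewrite -ler_sqr ?nnegrE ?sqrtr_ge0// sqr_sqrtr//.
by apply: sumr_ge0 => i _; exact: sqr_ge0.
Qed.

Lemma euclidean_normN v : euclidean_norm (- v) = euclidean_norm v.
Proof.
by congr Num.sqrt; apply: eq_bigr => i _; rewrite mxE sqrrN.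
Qed.

(* Termwise, [(s + t)^2 <= (1 + q / p) s^2 + (1 + p / q) t^2], so no
   Cauchy-Schwarz inequality is needed. *)
Lemma euclidean_normD_le u v p q : 0 < p -> 0 < q ->
  euclidean_norm u <= p -> euclidean_norm v <= q ->
  euclidean_norm (u + v) <= p + q.
Proof.
move=> p0 q0; have [p0' q0'] : 0 <= p /\ 0 <= q by rewrite !ltW.
rewrite !euclidean_norm_le ?addr_ge0// => up vq.
apply: (@le_trans _ _ (\sum_i ((1 + q / p) * u ord0 i ^+ 2
    + (1 + p / q) * v ord0 i ^+ 2))).
  apply: ler_sum => i _; rewrite mxE; set s := u _ _; set t := v _ _.
  rewrite -subr_ge0 (_ : _ - _ = (q * s - p * t) ^+ 2 / (p * q)).
    by rewrite divr_ge0 ?sqr_ge0// mulr_ge0.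
  by field; rewrite !gt_eqF.
rewrite big_split/= -!mulr_sumr.
apply: (@le_trans _ _ ((1 + q / p) * p ^+ 2 + (1 + p / q) * q ^+ 2)).
  by apply: lerD; rewrite ler_wpM2l// addr_ge0// divr_ge0.
rewrite le_eqVlt; apply/orP; left; apply/eqP; field.
by rewrite !gt_eqF.
Qed.

Lemma closed_ball_sub x m r p : 0 < r -> 0 < p ->
  euclidean_norm (x - m) <= p -> closed_ball x r `<=` closed_ball m (p + r).
Proof.
move=> r0 p0 xm y yx; rewrite /closed_ball/= -(subrKA x) addrC.
exact: euclidean_normD_le.
Qed.

(* By the parallelogram law a point at distance at most [2] from both [x] and
   [y] is within [sqrt (4 - |x - y|^2 / 4)] of their midpoint. *)
Lemma lens_sub_closed_ball x y z (e : R) : 0 <= e -> e <= 1 ->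
  euclidean_norm (x - z) <= 2 -> euclidean_norm (y - z) <= 2 ->
  2 - e < euclidean_norm (x - y) ->
  euclidean_norm (z - 2^-1 *: (x + y)) <= Num.sqrt (3 + e).
Proof.
move=> e0 e1; rewrite !euclidean_norm_le// ?sqrtr_ge0// => xz yz.
rewrite ltNge euclidean_norm_le; last lra.
rewrite -ltNge sqr_sqrtr; last lra.
set S := \sum_i (x - y) ord0 i ^+ 2 => xy.
have -> : \sum_i (z - 2^-1 *: (x + y)) ord0 i ^+ 2 =
    2^-1 * (\sum_i (x - z) ord0 i ^+ 2 + \sum_i (y - z) ord0 i ^+ 2) - 4^-1 * S.
  rewrite -big_split !mulr_sumr -sumrB; apply: eq_bigr => i _.
  by rewrite !mxE/=; field.
nra.
Qed.

Lemma translate_unit_ball v :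
  [set x + v | x in euclidean_unit_ball R d] = closed_ball v 1.
Proof.
apply/seteqP; split => [_ [x xB <-]|y yv]; rewrite /closed_ball/=.
  by rewrite addrK.
by exists (y - v); rewrite ?subrK.
Qed.

(** [vol] measures row vectors through tuples, so measurability is stated for this preimage. *)
Definition tuple_set (A : set 'rV[R]_d) : set (d.-tuple (measurableTypeR R)) :=
  [set t | A (\row_i tnth t i)].

Lemma measurable_closed_ball x r : 0 <= r ->
  measurable (tuple_set (closed_ball x r)).
Proof.
move=> r0.
pose f (t : d.-tuple (measurableTypeR R)) : R := \sum_(i < d) (tnth t i - x ord0 i) ^+ 2.
have mf : measurable_fun setT f.
  apply: measurable_sum => i; apply: measurable_funX; apply: measurable_funB => //.
  exact: measurable_tnth.
rewrite (_ : tuple_set _ = f @^-1` [set` `]-oo, r ^+ 2]]).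
  by rewrite -[X in measurable X]setTI; apply: mf => //; exact: measurable_itv.
apply/seteqP; split => t; rewrite /tuple_set /closed_ball/= euclidean_norm_le// in_itv/=;
  by under eq_bigr do rewrite !mxE.
Qed.

Lemma vol_closed_ball x r : 0 < r ->
  (vol (closed_ball x r) = (r ^+ d)%:E * vol (euclidean_unit_ball R d))%E.
Proof.
move=> r0; have ir0 : 0 < r^-1 by rewrite invr_gt0.
have mB : measurable (tuple_set (closed_ball 0 1)) by exact: measurable_closed_ball.
have B0 : euclidean_unit_ball R d = closed_ball 0 1.
  by apply/seteqP; split => y; rewrite /closed_ball/= subr0.
(* The map sending [y] to [(y - x) / r] carries the ball to the unit ball. *)
have := lebesgue_tuple_affine (fun i => - (r^-1 * x ord0 i)) ir0 mB.
rewrite B0 -[vol (closed_ball 0 1)]/(lebesgue_tuple R d (tuple_set _)) => <-.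
rewrite muleA -EFinM -exprMn divff ?gt_eqF//.
rewrite expr1n mul1e /vol; congr (lebesgue_tuple R d _).
apply/seteqP; split => t; rewrite /tuple_set /closed_ball/= !euclidean_norm_le// ?(ltW r0)//;
  rewrite expr1n => h.
  under eq_bigr do rewrite !mxE tnth_mktuple subr0 -mulrBr exprMn.
  rewrite -mulr_sumr exprVn ler_pdivrMl ?exprn_gt0// mulr1.
  by move: h; under eq_bigr do rewrite !mxE.
move: h; under eq_bigr do rewrite !mxE tnth_mktuple subr0 -mulrBr exprMn.
rewrite -mulr_sumr exprVn ler_pdivrMl ?exprn_gt0// mulr1.
by under [in X in _ -> X]eq_bigr do rewrite !mxE.
Qed.

(** The unit ball lies in the cube with [s = 1] and contains the one with [s = 1 / d], so its volume
    is finite and positive. *)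
Definition cube (s : R) : set (d.-tuple (measurableTypeR R)) :=
  [set t | forall i, [set` `[- s, s]] (tnth t i)].

Lemma measurable_cube s : measurable (cube s).
Proof.
rewrite (_ : cube s =
    \bigcap_(i in [set: 'I_d]) ((@tnth d _)^~ i @^-1` [set` `[- s, s]])).
  apply: fin_bigcap_measurable => // i _.
  by rewrite -[X in measurable X]setTI; exact: measurable_tnth.
by apply/seteqP; split => [t h i _|t h i]; [exact: h|exact: (h i)].
Qed.

Lemma measurable_unit_ball : measurable (tuple_set (euclidean_unit_ball R d)).
Proof.
have := @measurable_closed_ball 0 1 ler01.
by rewrite /tuple_set /closed_ball /=; under eq_set do rewrite subr0.
Qed.

Lemma lebesgue_tuple_cube (s : R) : 0 < s ->
  lebesgue_tuple R d (cube s) = ((2 * s) ^+ d)%:E.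
Proof.
move=> s0; rewrite (lebesgue_tuple_box (A := fun=> [set` `[- s, s]])); last first.
  by move=> i; exact: measurable_itv.
under eq_bigr do rewrite lebesgue_measure_itv/= lte_fin.
rewrite (_ : - s < s); last lra.
rewrite -EFinB prodEFin prodr_const card_ord; congr (_ ^+ _)%:E; ring.
Qed.

Lemma vol_unit_ball_lty : (vol (euclidean_unit_ball R d) < +oo)%E.
Proof.
rewrite (@le_lt_trans _ _ ((2 * 1) ^+ d)%:E) ?ltry//.
rewrite -lebesgue_tuple_cube//; apply: le_measure; rewrite ?inE.
- exact: measurable_unit_ball.
- exact: measurable_cube.
move=> t /=; rewrite /euclidean_unit_ball/= euclidean_norm_le// expr1n => h i.
rewrite /= in_itv/= -ler_norml -(@expr_le1 _ 2)//.
rewrite real_normK ?num_real//; apply: le_trans h.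
rewrite (bigD1 i)//= mxE lerDl; apply: sumr_ge0 => j _; exact: sqr_ge0.
Qed.

Lemma vol_unit_ball_gt0 : (0 < d)%N -> (0 < vol (euclidean_unit_ball R d))%E.
Proof.
move=> d0; have s0 : 0 < d%:R^-1 :> R by rewrite invr_gt0 ltr0n.
apply: (@lt_le_trans _ _ ((2 * d%:R^-1) ^+ d)%:E).
  by rewrite lte_fin exprn_gt0// mulr_gt0.
rewrite -lebesgue_tuple_cube//; apply: le_measure; rewrite ?inE.
- exact: measurable_cube.
- exact: measurable_unit_ball.
move=> t /= h; rewrite /euclidean_unit_ball/= euclidean_norm_le// expr1n.
apply: (@le_trans _ _ (\sum_(i < d) d%:R^-1)).
  apply: ler_sum => i _; rewrite mxE; have := h i.
  rewrite /= in_itv/= -ler_norml => hi.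
  rewrite -real_normK ?num_real// expr2 -[leRHS]mul1r ler_pM//.
  by rewrite (le_trans hi)// invf_le1 ?ler1n// ltr0n.
by rewrite sumr_const card_ord -[leLHS]mulr_natr mulVf// pnatr_eq0 -lt0n.
Qed.

End EuclideanBalls.

(** * Packing *)

Definition unit_ball_volume (R : realType) (d : nat) : R :=
  fine (vol (euclidean_unit_ball R d)).

Lemma vol_unit_ballE (R : realType) (d : nat) :
  vol (euclidean_unit_ball R d) = (unit_ball_volume R d)%:E.
Proof.
rewrite fineK// ge0_fin_numE; first exact: vol_unit_ball_lty.
exact: measure_ge0.
Qed.

Section Cells.
Context {R : realType} {d n : nat} (v : 'I_n -> 'rV[R]_d).
Implicit Types (i j : 'I_n) (P : pred 'I_n).

(** For [r = 2] the unit balls meet, tangency included; [r = 2 - e] singles out the close pairs. *)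
Definition intersects (r : R) : rel 'I_n :=
  fun i j => euclidean_norm (v i - v j) <= r.

Lemma intersects_sym r : symmetric (intersects r).
Proof. by move=> i j; rewrite /intersects -euclidean_normN opprB. Qed.

Lemma intersects_refl r : 0 <= r -> reflexive (intersects r).
Proof.
move=> r0 i; rewrite /intersects subrr euclidean_norm_le//.
by rewrite big1 ?exprn_ge0// => j _; rewrite mxE expr0n.
Qed.

Let B i := tuple_set (closed_ball (v i) 1).

(** Each point of the union goes to the first ball containing it; a repeated centre gets an empty
    cell. *)
Definition cell i := B i `\` \bigcup_(j in [set j : 'I_n | (j < i)%N]) B j.

Definition cell_volume i : R := fine (lebesgue_tuple R d (cell i)).

Local Notation b := (unit_ball_volume R d).

Let mB i : measurable (B i).
Proof. exact: measurable_closed_ball. Qed.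

Lemma measurable_cell i : measurable (cell i).
Proof.
by apply: measurableD => //; apply: fin_bigcup_measurable => // j _.
Qed.

Lemma trivIset_cell : trivIset setT cell.
Proof.
move=> i j _ _ [t [[Bi ni] [Bj nj]]]; apply/val_inj/eqP.
rewrite eqn_leq; apply/andP; split; rewrite leqNgt; apply/negP => ij.
  by apply: ni; exists j.
by apply: nj; exists i.
Qed.

Lemma bigcup_cell : \bigcup_i cell i = \bigcup_i B i.
Proof.
apply/seteqP; split=> t [i _]; first by case=> Bi _; exists i.
move=> Bi; have [j Bj jmin] := @arg_minnP _ i (fun j => `[< B j t >]) val (asboolT Bi).
exists j => //; split; first exact: (asboolW Bj).
by move=> [k /= kj Bk]; have := jmin k (asboolT Bk); rewrite leqNgt kj.
Qed.

Lemma lebesgue_cell i : lebesgue_tuple R d (cell i) = (cell_volume i)%:E.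
Proof.
rewrite fineK// ge0_fin_numE; last exact: measure_ge0.
apply: (@le_lt_trans _ _ (vol (closed_ball (v i) 1))).
  by apply: le_measure; rewrite ?inE; [exact: measurable_cell|exact: mB|move=> t []].
by rewrite vol_closed_ball// expr1n mul1e vol_unit_ball_lty.
Qed.

Lemma cell_volume_ge0 i : 0 <= cell_volume i.
Proof. exact/fine_ge0/measure_ge0. Qed.

Lemma sum_cell_volume P :
  (\sum_(i | P i) cell_volume i)%:E = lebesgue_tuple R d (\bigcup_(i in [set` P]) cell i).
Proof.
rewrite bigcup_pred measure_bigsetU_ord.
- by rewrite -sumEFin; apply: eq_bigr => i _; exact/esym/lebesgue_cell.
- exact: measurable_cell.
- exact: trivIset_cell.
Qed.

(** The cells are disjoint and lie within 1 of their centres, hence inside one ball of radius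
    [r + 1]. All degree and codegree bounds come from this. *)
Lemma sum_cell_volume_le P m (r : R) : 0 < r ->
  (forall i, P i -> euclidean_norm (v i - m) <= r) ->
  \sum_(i | P i) cell_volume i <= (r + 1) ^+ d * b.
Proof.
move=> r0 hP; rewrite -lee_fin sum_cell_volume.
apply: (@le_trans _ _ (vol (closed_ball m (r + 1)))); last first.
  by rewrite vol_closed_ball ?addr_gt0// vol_unit_ballE.
apply: le_measure; rewrite ?inE.
- by apply: fin_bigcup_measurable => // i _; exact: measurable_cell.
- by apply: measurable_closed_ball; rewrite addr_ge0// ltW.
- move=> t [i /= Pi [Bi _]].
  exact: (closed_ball_sub ltr01 r0 (hP i Pi)).
Qed.

Lemma total_cell_volume :
  vol (\bigcup_i closed_ball (v i) 1) = (\sum_i cell_volume i)%:E.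
Proof.
rewrite sum_cell_volume (_ : [set` predT] = setT).
  by rewrite bigcup_cell.
by apply/seteqP; split.
Qed.

Lemma closed_ball_meet i j t : closed_ball (v i) 1 t -> closed_ball (v j) 1 t ->
  intersects 2 i j.
Proof.
move=> it jt; rewrite /intersects (_ : 2 = 1 + 1)// -(subrKA t).
by apply: euclidean_normD_le => //; rewrite -euclidean_normN opprB.
Qed.

Lemma vol_independent (I : {set 'I_n}) : independent (intersects 2) I ->
  vol (\bigcup_(i in [set` I]) closed_ball (v i) 1) = (#|I|%:R * b)%:E.
Proof.
move=> /independentP iI.
have -> : vol (\bigcup_(i in [set` I]) closed_ball (v i) 1) =
    lebesgue_tuple R d (\bigcup_(i in [set` I]) B i) by [].
rewrite bigcup_pred measure_bigsetU_ord_cond//.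
  rewrite (eq_bigr (fun=> b%:E)) => [|i _].
    by rewrite sumEFin sumr_const mulr_natl.
  by rewrite -[LHS]/(vol _) vol_closed_ball// expr1n mul1e vol_unit_ballE.
move=> i j /= iI' jI [t [Bi Bj]]; apply: iI => //.
exact: closed_ball_meet Bi Bj.
Qed.

End Cells.

(** * From independent sets to disjoint balls *)

Section Packing.
Context {R : realType} {d : nat}.
Hypothesis d_gt0 : (0 < d)%N.
Local Notation b := (unit_ball_volume R d).

Lemma unit_ball_volume_gt0 : 0 < b.
Proof. by rewrite -lte_fin -vol_unit_ballE; exact: vol_unit_ball_gt0. Qed.

Lemma disjoint_balls_ge n (v : 'I_n -> 'rV[R]_d) (e delta k a : R) :
  let K := (Num.sqrt (3 + e) + 1) ^+ d in
  0 < e -> e <= 1 -> 0 < k -> k < 1 -> 0 <= a -> 0 <= delta ->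
  (3 - e) ^+ d <= delta * 3 ^+ d ->
  a <= k * 3 ^+ d / K * expR (- a) * (1 - (1 + a) * delta * a) ->
  exists I : {set 'I_n}, independent (intersects v 2) I /\
    (1 - k) * a * 3 ^- d * (\sum_i cell_volume v i) <= #|I|%:R * b.
Proof.
move=> K e0 e1 k0 k1 a0 delta0 hdelta ha; have b0 := unit_ball_volume_gt0.
have K0 : 0 < K by rewrite exprn_gt0// ltr_wpDl// sqrtr_ge0.
(* Scaled by [lambda], codegrees of distant neighbours are at most [k] and degrees at most
   [k * 3 ^+ d / K]. *)
pose lambda := k / (K * b).
have l0 : 0 < lambda by rewrite divr_gt0// mulr_gt0.
have d30 : 0 < 3 ^+ d :> R by rewrite exprn_gt0.
have [I [iI hI]] : exists I : {set 'I_n}, independent (intersects v 2) I /\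
    (1 - k) * a * (\sum_i lambda * cell_volume v i) / (k * 3 ^+ d / K) <= #|I|%:R.
  apply: (@large_independent_set _ _ _ (intersects v (2 - e)) _ _ delta).
  - exact: intersects_refl.
  - exact: intersects_sym.
  - exact: intersects_sym.
  - by move=> i j; rewrite /intersects => h; apply: (le_trans h); lra.
  - by move=> i; rewrite mulr_ge0 ?cell_volume_ge0// ltW.
  - move=> i; rewrite -mulr_sumr.
    apply: (@le_trans _ _ (lambda * ((2 + 1) ^+ d * b))).
      rewrite ler_wpM2l ?(ltW l0)//; apply: (sum_cell_volume_le (m := v i)) => // j.
      by rewrite intersects_sym.
    rewrite le_eqVlt; apply/orP; left; apply/eqP.
    rewrite (_ : 2 + 1 = 3 :> R); last ring.
    by rewrite /lambda; field; rewrite !gt_eqF.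
  - move=> i; rewrite -mulr_sumr.
    apply: (@le_trans _ _ (lambda * ((2 - e + 1) ^+ d * b))).
      rewrite ler_wpM2l ?(ltW l0)//; apply: (sum_cell_volume_le (m := v i)) => [|j].
        by lra.
      by rewrite intersects_sym.
    rewrite (_ : 2 - e + 1 = 3 - e :> R); last ring.
    rewrite (_ : delta * _ = lambda * (delta * 3 ^+ d * b)).
      by rewrite ler_pM2l// ler_pM2r.
    by rewrite /lambda; field; rewrite !gt_eqF.
  - move=> i j ij nij; rewrite -mulr_sumr.
    apply: (@le_trans _ _ (lambda * (K * b))); last first.
      rewrite le_eqVlt; apply/orP; left; apply/eqP.
      by rewrite /lambda; field; rewrite !gt_eqF.
    rewrite ler_wpM2l ?(ltW l0)//.
    apply: (sum_cell_volume_le (m := 2^-1 *: (v i + v j))).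
      by rewrite sqrtr_gt0; lra.
    move=> z /andP[iz jz]; apply: lens_sub_closed_ball iz jz _ => //; first exact: ltW.
    by rewrite ltNge.
  - by rewrite divr_gt0// mulr_gt0.
  - exact: delta0.
  - exact: ltW.
  - exact: k1.
  - exact: a0.
  - exact: ha.
exists I; split => //; rewrite -ler_pdivrMr//; apply: le_trans hI.
(* The scaling cancels: [lambda / (k * 3 ^+ d / K)] is [1 / (3 ^+ d * b)]. *)
rewrite -mulr_sumr le_eqVlt; apply/orP; left; apply/eqP.
by rewrite /lambda; field; rewrite !gt_eqF.
Qed.

(** The sequence listing [C] may repeat a ball; equal balls are adjacent, so an independent set of
    indices never uses both copies. *)
Lemma disjoint_fractions_mem (c : R) : 0 <= c ->
  (forall n (v : 'I_n -> 'rV[R]_d), exists I : {set 'I_n},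
    independent (intersects v 2) I /\
    c * (\sum_i cell_volume v i) <= #|I|%:R * b) ->
  disjoint_fractions (euclidean_unit_ball R d) c.
Proof.
move=> c0 hc; split => // C /finite_seqP[s sC] Ctr.
pose A (i : 'I_(size s)) := nth set0 s i.
have AC i : C (A i) by rewrite sC/= mem_nth.
have /choice[v Av] : forall i, exists v, A i = closed_ball v 1.
  by move=> i; have [w ->] := Ctr _ (AC i); exists w; exact: translate_unit_ball.
have [I [iI hI]] := hc _ v.
exists [set X | exists2 i, i \in I & X = A i]; split.
- by move=> _ [i _ ->].
- move=> _ _ [i iI' ->] [j jI ->] [t []]; rewrite !Av => it jt; congr closed_ball.
  by move/independentP : iI => /(_ i j iI' jI (closed_ball_meet it jt)) ->.
have -> : \bigcup_(X in C) X = \bigcup_i closed_ball (v i) 1.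
  apply/seteqP; split => [t [X]|t [i _]].
    rewrite sC/= => /(nthP set0)[i si <-] ti.
    by exists (Ordinal si) => //; rewrite -Av.
  by rewrite -Av => ti; exists (A i).
have -> : \bigcup_(X in [set X | exists2 i, i \in I & X = A i]) X =
    \bigcup_(i in [set` I]) closed_ball (v i) 1.
  apply/seteqP; split => [t [_ [i iI' ->]]|t [i /= iI']].
    by rewrite Av => ti; exists i.
  by rewrite -Av => ti; exists (A i) => //; exists i.
by rewrite total_cell_volume vol_independent// -EFinM lee_fin.
Qed.

(** Testing on a single ball bounds all admissible constants, so the supremum is a genuine one. *)
Lemma disjoint_fractions_le1 (c : R) :
  disjoint_fractions (euclidean_unit_ball R d) c -> c <= 1.
Proof.
move=> [c0 hc]; have b0 := unit_ball_volume_gt0.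
have [||S [SC _]] := hc [set closed_ball 0 1].
- exact: finite_set1.
- by move=> _ ->; exists 0; rewrite translate_unit_ball.
rewrite bigcup_set1 => h.
rewrite -(ler_pM2r b0) mul1r -lee_fin EFinM -vol_unit_ballE.
have B0 : vol (closed_ball (0 : 'rV[R]_d) 1) = vol (euclidean_unit_ball R d).
  by rewrite vol_closed_ball// expr1n mul1e.
rewrite -B0; apply: (le_trans h).
have [S0|/set0P[X SX]] := eqVneq S set0.
  by rewrite S0 bigcup_set0 [X in (X <= _)%E](_ : _ = 0%E) ?measure_ge0//.
rewrite (_ : \bigcup_(A in S) A = closed_ball 0 1)//.
apply/seteqP; split => [t [Y /SC ->]//|t t0]; exists X => //.
by rewrite (SC _ SX).
Qed.

Lemma max_disjoint_fraction_ge (c : R) :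
  disjoint_fractions (euclidean_unit_ball R d) c ->
  c <= max_disjoint_fraction (euclidean_unit_ball R d).
Proof.
move=> hc; apply: ub_le_sup => //.
by exists 1 => x /disjoint_fractions_le1.
Qed.

Lemma max_disjoint_fraction_ge0 : 0 <= max_disjoint_fraction (euclidean_unit_ball R d).
Proof.
apply/max_disjoint_fraction_ge/disjoint_fractions_mem => // n v.
exists finset.set0; split; first by apply/forall_inP => i; rewrite inE.
by rewrite mul0r mulr_ge0// ltW// unit_ball_volume_gt0.
Qed.

End Packing.

(** * Logarithmic estimates and the choice of parameters *)

Section Asymptotics.
Context {R : realType}.

Lemma sqrt_ge1 (x : R) : 1 <= x -> 1 <= Num.sqrt x.
Proof. by move=> x1; rewrite -[leLHS]sqrtr1 ler_sqrt//; lra. Qed.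

Lemma sqrtD_le (x e : R) : 1 <= x -> 0 <= e -> Num.sqrt (x + e) <= Num.sqrt x + e.
Proof.
move=> x1 e0; have s1 := sqrt_ge1 x1.
have xe0 : 0 <= x + e by lra.
have se0 : 0 <= Num.sqrt x + e by lra.
rewrite -(@ler_sqr R) ?nnegrE ?sqrtr_ge0// sqr_sqrtr//.
have : Num.sqrt x ^+ 2 = x by rewrite sqr_sqrtr//; lra.
nra.
Qed.

Lemma ln_le_subr1 (x : R) : 0 < x -> ln x <= x - 1.
Proof.
move=> x0; rewrite -[X in ln X](_ : 1 + (x - 1) = x); last ring.
apply: le_ln1Dx; lra.
Qed.

Lemma ln_lens_ratio_le (e : R) : 0 <= e ->
  ln (3 / (Num.sqrt (3 + e) + 1)) <= 1.
Proof.
move=> e0; have s0 : 0 <= Num.sqrt (3 + e) by rewrite sqrtr_ge0.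
apply: (@le_trans _ _ (3 / (Num.sqrt (3 + e) + 1) - 1)).
  by apply: ln_le_subr1; rewrite divr_gt0//; lra.
have s1 : 1 <= Num.sqrt (3 + e) by apply: sqrt_ge1; lra.
rewrite lerBlDr ler_pdivrMr; lra.
Qed.

(** [Num.sqrt (3 + e) + 1] is at most [1 + Num.sqrt 3 + e], hence at most
    [(1 + Num.sqrt 3) * expR e]. *)
Lemma ln_lens_ratio_ge (e : R) : 0 <= e ->
  ln (3 / (1 + Num.sqrt 3)) - e <= ln (3 / (Num.sqrt (3 + e) + 1)).
Proof.
move=> e0; have s1 : 1 <= Num.sqrt (3 : R) by apply: sqrt_ge1; lra.
have h := @sqrtD_le 3 e ltac:(lra) e0.
have t0 : 0 <= Num.sqrt (3 + e) by rewrite sqrtr_ge0.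
rewrite !ln_div ?posrE //; try lra.
suff : ln (Num.sqrt (3 + e) + 1) <= ln (1 + Num.sqrt 3) + e by lra.
rewrite -[X in _ <= _ + X]expRK -lnM ?posrE ?expR_gt0//; try lra.
rewrite ler_ln ?posrE ?mulr_gt0 ?expR_gt0//; try lra.
have := expR_ge1Dx e; nra.
Qed.

Lemma ln_ge1 (d : nat) : (16 <= d)%N -> 1 <= ln (d%:R : R).
Proof.
move=> d16; apply: (@le_trans _ _ (ln ((2 : R) ^+ 4))); last first.
  rewrite ler_ln ?posrE ?exprn_gt0// ?ltr0n; last by case: d d16.
  by rewrite -natrX ler_nat.
rewrite lnXn//; suff : 2^-1 <= ln (2 : R) by rewrite -mulr_natr; lra.
have := @ln_le_subr1 2^-1; rewrite lnV ?posrE//; lra.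
Qed.

End Asymptotics.

Theorem theorem1p6 (R : realType) :
  exists (C : R) (d0 : nat), 0 < C /\
    forall d : nat, (d0 <= d)%N ->
      (ln (3 / (1 + Num.sqrt 3)) - C * (ln d%:R / d%:R)) * d%:R * 3 ^- d
        <= max_disjoint_fraction (euclidean_unit_ball R d).
Proof.
(* The 13 splits as 9 from [e], 3 from the definition of [a], and 1 from the factor [1 - D^-1]. From
   16 on, [ln D >= 1]. *)
exists 13, 16%N; split=> // d d16.
have d_gt0 : (0 < d)%N by case: d d16.
set L := ln (3 / _).
have D0 : 0 < d%:R :> R by rewrite ltr0n.
have D16 : 16 <= d%:R :> R by rewrite (ler_nat R 16).
set D := d%:R : R in D0 D16 *.
have l1 : 1 <= ln D by exact: ln_ge1.
have T0 : 0 < 3 ^- d :> R by rewrite invr_gt0 exprn_gt0.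
have -> : (L - 13 * (ln D / D)) * D = L * D - 13 * ln D.
  by field; rewrite gt_eqF.
(* A nonpositive bound is trivial; otherwise [13 * ln D < L * D], which yields [e <= 1] and
   [0 <= a]. *)
have [neg|pos] := leP (L * D - 13 * ln D) 0.
  apply: (le_trans _ (max_disjoint_fraction_ge0 d_gt0)).
  by rewrite mulr_le0_ge0// ltW.
(* Chosen so that [(1 - e / 3) ^+ d <= expR (- (e / 3) * D) = D ^- 3], the value taken for
   [delta]. *)
pose e := 9 * (ln D / D).
have eD : e * D = 9 * ln D by rewrite /e; field; rewrite gt_eqF.
have e0 : 0 < e by rewrite mulr_gt0// divr_gt0//; lra.
have L1 : L <= 1.
  by rewrite /L addrC -[X in Num.sqrt X]addr0; exact: ln_lens_ratio_le.
have e1 : e <= 1.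
  rewrite -(ler_pM2r D0) mul1r eD; nra.
pose M := ln (3 / (Num.sqrt (3 + e) + 1)).
have M1 : M <= 1 by exact/ln_lens_ratio_le/ltW.
have ML : L - e <= M by exact/ln_lens_ratio_ge/ltW.
(* [M * D] is the logarithm of [3 ^+ d] over the lens bound. With [k = D^-1], subtracting [3 * ln D]
   leaves a factor [D ^+ 2] in the condition on [a]. *)
pose a := M * D - 3 * ln D.
have aL : L * D - 12 * ln D <= a by rewrite /a; nra.
have a0 : 0 <= a by lra.
have aD : a <= D by rewrite /a; nra.
have Dne : D != 0 by rewrite gt_eqF.
apply: (@le_trans _ _ ((1 - D^-1) * a * 3 ^- d)).
  rewrite ler_pM2r// mulrBl mul1r.
  have : D^-1 * a <= 1 by rewrite ler_pdivrMl// mulr1.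
  lra.
have k0 : 0 < D^-1 by rewrite invr_gt0.
have k1 : D^-1 < 1 by rewrite invf_lt1//; lra.
apply: max_disjoint_fraction_ge => //; apply: disjoint_fractions_mem => //.
  by rewrite !mulr_ge0// ?subr_ge0 ltW.
move=> n v; apply: (@disjoint_balls_ge _ _ d_gt0 n v e (D ^- 3)) => //.
- by rewrite invr_ge0 exprn_ge0// ltW.
- have expD : D ^- 3 = expR (- (e / 3) * D).
    rewrite (_ : - (e / 3) * D = - (3%:R * ln D)); last by rewrite mulNr mulrAC eD; field.
    by rewrite expRN expRM_natl lnK ?posrE.
  rewrite expD /D expRM_natr -exprMn lerXn2r ?nnegrE//; first lra.
  have := expR_ge1Dx (- (e / 3)); lra.
- set K := (Num.sqrt (3 + e) + 1).
  have K0 : 0 < K by rewrite ltr_wpDl// sqrtr_ge0.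
  have -> : D^-1 * 3 ^+ d / K ^+ d * expR (- a) = D ^+ 2.
    have -> : expR (- a) = D ^+ 3 * K ^+ d / 3 ^+ d.
      rewrite /a opprB expRD expRN expRM_natl lnK ?posrE//.
      rewrite [M * D]/(M * d%:R) expRM_natr /M lnK ?posrE ?divr_gt0// expr_div_n.
      by rewrite invf_div mulrA.
    by field; rewrite Dne !expf_neq0// ?gt_eqF.
  apply: (le_trans aD).
  (* Since [a <= D], the correction is at most one half, and [D <= D ^+ 2 / 2] finishes. *)
  have h : (1 + a) * D ^- 3 * a <= 2^-1.
    rewrite mulrAC ler_pdivrMr ?exprn_gt0//; nra.
  nra.
Qed.
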